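(* Let $(\mathscr{L},\vdash)$ be a finitary logical structure such that $\vdash$ satisfies monotonicity and transitivity. If there exists a nonempty finite $\vdash$-trivial set, then every $\vdash$-trivial subset of $\mathscr{L}$ contains a finite $\vdash$-trivial subset.
   Context: A logical structure is a pair $(\mathscr{L},\vdash)$ with $\mathscr{L}$ a set and $\vdash\,\subseteq\mathcal{P}(\mathscr{L})\times\mathscr{L}$. It is finitary if $\Gamma\vdash\alpha$ implies $\Gamma_0\vdash\alpha$ for some finite $\Gamma_0\subseteq\Gamma$. Monotonicity: $\Gamma\vdash\alpha$ and $\Gamma\subseteq\Sigma$ imply $\Sigma\vdash\alpha$. Transitivity: if $\Sigma\vdash\alpha$ and $\Gamma\vdash\beta$ for all $\beta\in\Sigma$, then $\Gamma\vdash\alpha$. A set $\Gamma\subseteq\mathscr{L}$ is $\vdash$-trivial if $\Gamma\vdash\beta$ for every $\beta\in\mathscr{L}$. *)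

(* Defs.v *)
From mathcomp Require Import all_boot.
From mathcomp Require Import boolp classical_sets functions cardinality.

Set Implicit Arguments.
Unset Strict Implicit.
Unset Printing Implicit Defensive.

Local Open Scope classical_set_scope.

(* The relation, a subset of P(L) x L, is given in curried form; nothing is
   assumed of it, and the carrier may be empty. *)
Record logical_structure := LogicalStructure {
  carrier :> Type;
  entails : set carrier -> carrier -> Prop
}.

Arguments entails : clear implicits.

Section Properties.
Variable L : logical_structure.

Definition finitary : Prop :=
  forall (Gamma : set L) (alpha : L), entails L Gamma alpha ->
    exists Gamma0 : set L,
      [/\ finite_set Gamma0, Gamma0 `<=` Gamma & entails L Gamma0 alpha].

Definition monotone : Prop :=
  forall (Gamma Sigma : set L) (alpha : L),
    entails L Gamma alpha -> Gamma `<=` Sigma -> entails L Sigma alpha.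

Definition transitive_entailment : Prop :=
  forall (Gamma Sigma : set L) (alpha : L),
    entails L Sigma alpha -> (forall beta : L, Sigma beta -> entails L Gamma beta) ->
    entails L Gamma alpha.

Definition trivial_set (Gamma : set L) : Prop :=
  forall beta : L, entails L Gamma beta.

End Properties.

Arguments finitary : clear implicits.
Arguments monotone : clear implicits.
Arguments transitive_entailment : clear implicits.

(* Main.v *)
Require Import Defs.
From mathcomp Require Import all_boot.
From mathcomp Require Import boolp classical_sets functions cardinality.

Local Open Scope classical_set_scope.

(* Each element of the finite trivial set Delta is entailed by a finite part of
   Gamma; the union of these parts over Delta is finite and entails Delta, hence
   is trivial by transitivity. *)

(** [Delta] is a finite test for triviality: by transitivity, a set entailing all of [Delta] entails
    everything. So only finitely many consequences of [Gamma] need finite support. *)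

Theorem theorem3p18 (L : logical_structure)
  (Hfin : finitary L) (Hmono : monotone L) (Htrans : transitive_entailment L)
  (Htriv : exists Delta : set L,
     [/\ Delta !=set0, finite_set Delta & trivial_set Delta]) :
  forall Gamma : set L, trivial_set Gamma ->
    exists Gamma0 : set L,
      [/\ finite_set Gamma0, Gamma0 `<=` Gamma & trivial_set Gamma0].
Proof.
move=> Gamma trivG; have [Delta [_ finD trivD]] := Htriv.
(* [Gamma] entails every formula, so finite supports can be chosen on the whole carrier at once. *)
have [f fP] := choice (fun delta => Hfin Gamma delta (trivG delta)).
exists (\bigcup_(delta in Delta) f delta); split.
- by apply: bigcup_finite => // delta _; have [] := fP delta.
- by apply: bigcup_sub => delta _; have [] := fP delta.
- move=> beta; apply: (Htrans _ Delta) (trivD beta) _ => delta Ddelta.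
  have [_ _ fdelta] := fP delta.
  (* Monotonicity lifts the entailment of [delta] from its own support to the union. *)
  exact: Hmono fdelta (bigcup_sup Ddelta).
Qed.
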